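(* Let $P=\{x\in\mathbb{R}^n : H^Tx\le \mathbb{1}\}$ be a full-dimensional polytope with the origin in its interior, with $f$ facets and $v$ vertices, let $K\subseteq\mathbb{R}^m$ be a closed convex cone, and let $A$ be a nonnegative $K^*$-map from $\mathbb{R}^f$ to $\mathbb{R}^m$ and $B$ a nonnegative $K$-map from $\mathbb{R}^v$ to $\mathbb{R}^m$. Then the convex sets $\mathrm{Inn}_P(A)$ and $\mathrm{Out}_P(B)$ have $K\times \mathrm{SOC}_{n+m+2}$-lifts.
   Context: Dual spaces are identified with the spaces themselves via the standard inner product; $\|\cdot\|$ is the Euclidean norm and $\mathbb{1}$ is the all-ones vector. $H=[h_1\ \cdots\ h_f]$ is an $n\times f$ matrix such that each inequality $\langle h_i,x\rangle\le 1$ defines a facet of $P$ (one for each facet); $p_1,\dots,p_v$ are the vertices of $P$ and $V=[p_1\ \cdots\ p_v]$ is $n\times v$. $K^*=\{y : \langle y,x\rangle\ge 0\ \forall x\in K\}$ is the dual cone. A nonnegative $K$-map $B:\mathbb{R}^v\to\mathbb{R}^m$ is a linear map with $B(\mathbb{R}^v_+)\subseteq K$; a nonnegative $K^*$-map $A:\mathbb{R}^f\to\mathbb{R}^m$ satisfies $A(\mathbb{R}^f_+)\subseteq K^*$. $A^*$ is the adjoint (transpose) of $A$, and $H^*(x)=H^Tx$. Cones: $\mathcal{O}_{in}^k=\{x\in\mathbb{R}^k : \sqrt{k-1}\,\|x\|\le \mathbb{1}^Tx\}$ and $\mathcal{O}_{out}^k=\{x\in\mathbb{R}^k : \|x\|\le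 \mathbb{1}^Tx\}$. Definitions: $\mathrm{Inn}_P(A)=\{x\in\mathbb{R}^n : \exists y\in K,\ \mathbb{1}-H^*(x)-A^*(y)\in\mathcal{O}_{in}^f\}$, $\mathrm{Out}_P(B)=\{V(z) : z\in\mathcal{O}_{out}^v,\ \mathbb{1}^Tz\le 1,\ B(z)\in K\}$. A convex set $C\subset\mathbb{R}^n$ has a $K'$-lift, for a closed convex cone $K'\subset\mathbb{R}^N$, if there are an affine subspace $L\subset\mathbb{R}^N$ and a linear map $\pi:\mathbb{R}^N\to\mathbb{R}^n$ with $C=\pi(K'\cap L)$. An $\mathrm{SOC}_k$ ($k$-second order cone) is any set of the form $\{z\in\mathbb{R}^k : \|Q^{1/2}z\|\le a^Tz\}$ with $Q$ a $k\times k$ positive semidefinite matrix, $Q^{1/2}$ a $k\times k$ matrix with $(Q^{1/2})^TQ^{1/2}=Q$, and $a\in\mathbb{R}^k$. Having a $K\times\mathrm{SOC}_k$-lift means having a $(K\times K'')$-lift for some $k$-second order cone $K''$. *)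

(* Defs.v *)
From HB Require Import structures.
From mathcomp Require Import all_boot all_order all_algebra.
From mathcomp Require Import all_classical all_reals all_analysis.

Set Implicit Arguments.
Unset Strict Implicit.
Unset Printing Implicit Defensive.

Import Order.TTheory GRing.Theory Num.Theory.
Import numFieldNormedType.Exports.

Local Open Scope classical_set_scope.
Local Open Scope ring_scope.

Section Euclidean.
Context {R : realType}.

Definition dot k (u w : 'cV[R]_k) : R := \sum_i u i 0 * w i 0.

(* The norm that MathComp-Analysis puts on matrices is the sup norm; it induces
   the same topology, so [closed] and [interior] below are the usual ones. *)
Definition enorm k (u : 'cV[R]_k) : R := Num.sqrt (dot u u).

Definition ones k : 'cV[R]_k := const_mx 1.

Definition orthant k : set 'cV[R]_k := [set x | forall i, 0 <= x i 0].

Definition convex_hull k (S : set 'cV[R]_k) : set 'cV[R]_k :=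
  [set x | exists N (w : 'I_N -> R) (q : 'I_N -> 'cV[R]_k),
    [/\ forall i, S (q i), forall i, 0 <= w i, \sum_i w i = 1 &
        x = \sum_i w i *: q i]].

Definition affine_hull k (S : set 'cV[R]_k) : set 'cV[R]_k :=
  [set x | exists N (w : 'I_N -> R) (q : 'I_N -> 'cV[R]_k),
    [/\ forall i, S (q i), \sum_i w i = 1 & x = \sum_i w i *: q i]].

Definition flat k (x0 : 'cV[R]_k) (U : {vspace 'cV[R]_k}) : set 'cV[R]_k :=
  [set x | x - x0 \in U].

Definition affine_subspace k (L : set 'cV[R]_k) : Prop :=
  exists x0 U, L = flat x0 U.

(* No [d] satisfies [affine_dim set0 d]. *)
Definition affine_dim k (S : set 'cV[R]_k) (d : nat) : Prop :=
  exists x0 U, affine_hull S = flat x0 U /\ \dim U = d.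

End Euclidean.

Section Polytopes.
Context {R : realType}.

Definition polyhedron n f (H : 'M[R]_(n, f)) : set 'cV[R]_n :=
  [set x | forall i, dot (col i H) x <= 1].

Definition is_polytope n (P : set 'cV[R]_n) : Prop :=
  exists S, finite_set S /\ P = convex_hull S.

Definition is_face n (P F : set 'cV[R]_n) : Prop :=
  exists c b, (forall x, P x -> dot c x <= b) /\
              F = P `&` [set x | dot c x = b].

Definition is_facet n (P F : set 'cV[R]_n) : Prop :=
  is_face P F /\ exists d, affine_dim F d /\ affine_dim P d.+1.

Definition is_vertex n (P : set 'cV[R]_n) (x : 'cV[R]_n) : Prop :=
  is_face P [set x].

Definition facet_cut n f (P : set 'cV[R]_n) (H : 'M[R]_(n, f)) (i : 'I_f) :
    set 'cV[R]_n :=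
  P `&` [set x | dot (col i H) x = 1].

Definition columns_define_facets n f (P : set 'cV[R]_n) (H : 'M[R]_(n, f)) :
    Prop :=
  injective (facet_cut P H) /\
  forall F, is_facet P F <-> exists i, F = facet_cut P H i.

Definition columns_are_vertices n v (P : set 'cV[R]_n) (V : 'M[R]_(n, v)) :
    Prop :=
  injective (fun j => col j V) /\
  forall x, is_vertex P x <-> exists j, x = col j V.

End Polytopes.

Section Cones.
Context {R : realType}.

Definition closed_convex_cone m (K : set 'cV[R]_m) : Prop :=
  [/\ closed K, convex_set K, K 0 &
      forall (c : R) x, 0 <= c -> K x -> K (c *: x)].

Definition dual_cone m (K : set 'cV[R]_m) : set 'cV[R]_m :=
  [set y | forall x, K x -> 0 <= dot y x].

Definition nonneg_map k m (C : set 'cV[R]_m) (M : 'M[R]_(m, k)) : Prop :=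
  forall x, orthant x -> C (M *m x).

(* For [k = 0] the square root is [0], and the cone is the whole of R^0. *)
Definition O_in k : set 'cV[R]_k :=
  [set x | Num.sqrt (k%:R - 1) * enorm x <= dot (ones k) x].

Definition O_out k : set 'cV[R]_k := [set x | enorm x <= dot (ones k) x].

Definition Inn n m f (H : 'M[R]_(n, f)) (K : set 'cV[R]_m)
    (A : 'M[R]_(m, f)) : set 'cV[R]_n :=
  [set x | exists y, K y /\ O_in (ones f - H^T *m x - A^T *m y)].

Definition Out n m v (V : 'M[R]_(n, v)) (K : set 'cV[R]_m)
    (B : 'M[R]_(m, v)) : set 'cV[R]_n :=
  [set V *m z | z in [set z | [/\ O_out z, dot (ones v) z <= 1 &
                                  K (B *m z)]]].

End Cones.

Section Lifts.
Context {R : realType}.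

Definition psd k (Q : 'M[R]_k) : Prop :=
  Q^T = Q /\ forall z : 'cV[R]_k, 0 <= dot z (Q *m z).

Definition is_SOC k (S : set 'cV[R]_k) : Prop :=
  exists (Q Qhalf : 'M[R]_k) (a : 'cV[R]_k),
    [/\ psd Q, Qhalf^T *m Qhalf = Q &
        S = [set z | enorm (Qhalf *m z) <= dot a z]].

(* The product K x K'' in R^(m + k), identified with R^m x R^k. *)
Definition prod_cone m k (K : set 'cV[R]_m) (K'' : set 'cV[R]_k) :
    set 'cV[R]_(m + k) :=
  [set col_mx y z | y in K & z in K''].

(* Having a lift presupposes that [C] is convex and [K'] a closed convex cone;
   both are part of the definition. *)
Definition has_lift N n (K' : set 'cV[R]_N) (C : set 'cV[R]_n) : Prop :=
  [/\ convex_set C, closed_convex_cone K' &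
      exists (L : set 'cV[R]_N) (pi : {linear 'cV[R]_N -> 'cV[R]_n}),
        affine_subspace L /\ C = pi @` (K' `&` L)].

Definition has_cone_SOC_lift m n (K : set 'cV[R]_m) (k : nat)
    (C : set 'cV[R]_n) : Prop :=
  exists K'' : set 'cV[R]_k, is_SOC K'' /\ has_lift (prod_cone K K'') C.

End Lifts.

(* Main.v *)
(* Both sets are of the form [{D w : |N w| <= a.w, b.w = 1, U w in K}]
   with [w] in [R^(n+m+2)]; such a set is a slice of [K x SOC] because [N] enters
   only through its Gram matrix [N^T N], which has a square factor.  For [Inn],
   take [w = (x, y, t, _)] with [t = 1].  For [Out], the origin is a convex
   combination of the vertices, so the constraint [1.z <= 1] may be replaced by
   [1.z = 1]; then [z] may be replaced by its orthogonal projection on the span of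
   the rows of [V], [B] and [1^T], which has only [n + m + 1] parameters. *)
Require Import Defs.
From mathcomp Require Import all_boot all_order all_algebra.
From mathcomp Require Import all_classical all_reals all_analysis.
From mathcomp Require Import lra.
Import Order.TTheory GRing.Theory Num.Theory.
Import numFieldNormedType.Exports.

Set Implicit Arguments.
Unset Strict Implicit.
Unset Printing Implicit Defensive.

Local Open Scope classical_set_scope.
Local Open Scope ring_scope.

Section Euclidean.
Context {R : realType}.
Implicit Types k : nat.

(** * Inner product and Euclidean norm *)

Lemma dotE k (u w : 'cV[R]_k) : dot u w = (u^T *m w) 0 0.
Proof. by rewrite mxE; apply: eq_bigr => i _; rewrite mxE. Qed.

Lemma dotC k (u w : 'cV[R]_k) : dot u w = dot w u.
Proof. by apply: eq_bigr => i _; rewrite mulrC. Qed.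

Lemma dotDr k (u w z : 'cV[R]_k) : dot u (w + z) = dot u w + dot u z.
Proof. by rewrite !dotE mulmxDr mxE. Qed.

Lemma dotDl k (u w z : 'cV[R]_k) : dot (w + z) u = dot w u + dot z u.
Proof. by rewrite dotC dotDr !(dotC u). Qed.

Lemma dotZr k (c : R) (u w : 'cV[R]_k) : dot u (c *: w) = c * dot u w.
Proof. by rewrite !dotE -scalemxAr mxE. Qed.

Lemma dotZl k (c : R) (u w : 'cV[R]_k) : dot (c *: w) u = c * dot w u.
Proof. by rewrite dotC dotZr dotC. Qed.

Lemma dot0r k (u : 'cV[R]_k) : dot u 0 = 0.
Proof. by rewrite dotE mulmx0 mxE. Qed.

Lemma dot_mulmx k l (M : 'M[R]_(l, k)) (u : 'cV[R]_l) (w : 'cV[R]_k) :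
  dot u (M *m w) = dot (M^T *m u) w.
Proof. by rewrite !dotE trmx_mul trmxK mulmxA. Qed.

Lemma dot_sumr k N (c : 'cV[R]_k) (w : 'I_N -> R) (q : 'I_N -> 'cV[R]_k) :
  dot c (\sum_i w i *: q i) = \sum_i w i * dot c (q i).
Proof.
rewrite dotE mulmx_sumr summxE; apply: eq_bigr => i _.
by rewrite -scalemxAr mxE dotE.
Qed.

Lemma dot_ge0 k (u : 'cV[R]_k) : 0 <= dot u u.
Proof. by apply: sumr_ge0 => i _; rewrite -expr2 sqr_ge0. Qed.

Lemma dot_eq0 k (u : 'cV[R]_k) : dot u u = 0 -> u = 0.
Proof.
move=> /eqP; rewrite psumr_eq0 => [/allP h|i _]; last by rewrite -expr2 sqr_ge0.
apply/colP => i; rewrite mxE; apply/eqP.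
by have := h i (mem_index_enum _); rewrite -expr2 sqrf_eq0.
Qed.

Lemma dot_gt0 k (u : 'cV[R]_k) : u != 0 -> 0 < dot u u.
Proof.
by rewrite lt_neqAle dot_ge0 andbT; apply: contra_neq => /esym/dot_eq0.
Qed.

Lemma dot_col_mx k l (u w : 'cV[R]_k) (u' w' : 'cV[R]_l) :
  dot (col_mx u u') (col_mx w w') = dot u w + dot u' w'.
Proof. by rewrite !dotE tr_col_mx mul_row_col mxE. Qed.

Lemma dotDD k (u w : 'cV[R]_k) (t : R) :
  dot (u + t *: w) (u + t *: w) = dot u u + 2 * t * dot u w + t ^+ 2 * dot w w.
Proof.
rewrite dotDl !dotDr !dotZl !dotZr (dotC w u); lra.
Qed.

(** The residual of [u] after projection on [w] has nonnegative squared norm; this is expanded by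
    [dotDD] and multiplied by [dot w w]. *)
Lemma cauchy_schwarz k (u w : 'cV[R]_k) : dot u w ^+ 2 <= dot u u * dot w w.
Proof.
have [->|w0] := eqVneq w 0; first by rewrite !dot0r expr0n mulr0.
have p0 := dot_gt0 w0.
have := dot_ge0 (u + (- (dot u w / dot w w)) *: w).
rewrite dotDD sqrrN expr_div_n mulrN mulNr.
have -> : dot u w ^+ 2 / dot w w ^+ 2 * dot w w = dot u w ^+ 2 / dot w w.
  by rewrite expr2 invfM mulrA -mulrA mulVf ?gt_eqF// mulr1 mulrAC.
have -> : 2 * (dot u w / dot w w) * dot u w = 2 * (dot u w ^+ 2 / dot w w).
  by rewrite -!mulrA; congr (_ * _); rewrite mulrCA mulrC mulrA.
move=> h; rewrite -ler_pdivrMr//; lra.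
Qed.

Lemma enorm_ge0 k (u : 'cV[R]_k) : 0 <= enorm u.
Proof. exact: sqrtr_ge0. Qed.

Lemma sqr_enorm k (u : 'cV[R]_k) : enorm u ^+ 2 = dot u u.
Proof. by rewrite sqr_sqrtr// dot_ge0. Qed.

Lemma ler_enormD k (u w : 'cV[R]_k) : enorm (u + w) <= enorm u + enorm w.
Proof.
rewrite -ler_sqr ?nnegrE ?addr_ge0 ?enorm_ge0// sqrrD !sqr_enorm.
rewrite -[w in X in X <= _]scale1r dotDD expr1n mul1r mulr1 lerD2r lerD2l.
rewrite -[leRHS]mulr_natl ler_pM2l// (le_trans (ler_norm _))//.
rewrite -ler_sqr ?nnegrE ?mulr_ge0 ?enorm_ge0// real_normK ?num_real//.
by rewrite exprMn !sqr_enorm cauchy_schwarz.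
Qed.

Lemma enormZ k (c : R) (u : 'cV[R]_k) : enorm (c *: u) = `|c| * enorm u.
Proof.
by rewrite /enorm dotZl dotZr mulrA -expr2 sqrtrM ?sqr_ge0// sqrtr_sqr.
Qed.

(** Each coordinate is at most the coordinate sum, so the sum of squares is at most the square of
    the sum. Thus [O_out] contains the orthant. *)
Lemma enorm_orthant k (q : 'cV[R]_k) :
  orthant q -> enorm q <= dot (ones k) q.
Proof.
move=> q0; have s0 : 0 <= dot (ones k) q.
  by apply: sumr_ge0 => i _; rewrite mxE mul1r.
rewrite -ler_sqr ?nnegrE ?enorm_ge0// sqr_enorm expr2 {2}/dot mulr_sumr.
apply: ler_sum => i _; rewrite mxE mul1r ler_wpM2r// /dot.
by rewrite (bigD1 i)//= mxE mul1r lerDl sumr_ge0// => j _; rewrite mxE mul1r.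
Qed.

(** * Gram matrices and orthogonal projection *)

(* One step of the Cholesky factorisation per column of [N]; if the column [u]
   vanishes then [r = 0] and [c = 0] (division by zero), so no case split is
   needed. *)
Lemma gram_square_factor p k (N : 'M[R]_(p, k)) :
  exists Q : 'M[R]_k, Q^T *m Q = N^T *m N.
Proof.
elim: k N => [|k IH] N; first by exists 0; apply/matrixP => - [].
pose u : 'cV[R]_p := lsubmx (N : 'M[R]_(p, 1 + k)).
pose M := rsubmx (N : 'M[R]_(p, 1 + k)).
pose r := enorm u; pose c : 'rV[R]_k := (dot u u)^-1 *: (u^T *m M).
have uu : u^T *m u = (r ^+ 2)%:M by rewrite sqr_enorm [LHS]mx11_scalar -dotE.
have uM : u^T *m M = r ^+ 2 *: c.
  rewrite sqr_enorm; have [u0|u0] := eqVneq u 0.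
    by rewrite /c u0 trmx0 mul0mx !scaler0.
  by rewrite scalerA mulfV ?scale1r// gt_eqF// dot_gt0.
have Mu : M^T *m u = r ^+ 2 *: c^T by rewrite -[LHS]trmxK trmx_mul trmxK uM linearZ.
(* The columns of [M - u *m c] are those of [M] made orthogonal to [u]. From here on [c] enters only
   through [uM] and [Mu]. *)
clearbody c; have [Q hQ] := IH (M - u *m c).
pose L : 'M[R]_(1 + k) := block_mx r%:M (r *: c) 0 Q.
suff LN : L^T *m L = (row_mx u M)^T *m row_mx u M.
  by exists L; apply: etrans LN _; rewrite hsubmxK.
rewrite tr_row_mx mul_col_row uu uM Mu /L tr_block_mx mulmx_block.
rewrite !trmx0 !mul0mx !mulmx0 !addr0 tr_scalar_mx -scalar_mxM -expr2.
rewrite mul_scalar_mx mul_mx_scalar !linearZ /= !scalerA -expr2.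
congr block_mx; rewrite hQ [(_ - _)^T]linearB /= trmx_mul mulmxBl !mulmxBr.
rewrite mulmxA Mu -(mulmxA c^T) uM -(mulmxA c^T) (mulmxA u^T) uu.
rewrite mul_scalar_mx -!scalemxAr -!scalemxAl.
by rewrite scalerA -expr2 subrr subr0 addrC subrK.
Qed.

(* [T^T *m w] is the orthogonal projection of [z] on the row space of [T]. *)
Lemma row_space_projection k v (T : 'M[R]_(k, v)) (z : 'cV[R]_v) :
  exists w : 'cV[R]_k, T *m (T^T *m w) = T *m z /\ enorm (T^T *m w) <= enorm z.
Proof.
(* If a row [x] satisfies [x *m T *m T^T = 0], then [x *m T] has squared norm zero. *)
have ker_sub : (kermx (T *m T^T) <= kermx T)%MS.
  apply/sub_kermxP; set X := kermx _; apply/row_matrixP => i; rewrite row0.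
  apply/trmx_inj; rewrite trmx0; apply: dot_eq0.
  have : (X *m T *m (X *m T)^T) i i = 0.
    by rewrite trmx_mul !mulmxA -(mulmxA X) mulmx_ker mul0mx mxE.
  by rewrite mxE => XT0; rewrite -[RHS]XT0; apply: eq_bigr => j _; rewrite !mxE.
(* Equality of ranks reverses the inclusion of row spaces, so the normal equations for [w] are
   solvable. *)
have sub : (T^T <= T *m T^T)%MS.
  rewrite -(mxrank_leqif_sup (submxMl T T^T)) eqn_leq mxrankM_maxr /=.
  have := mxrankS ker_sub; rewrite !mxrank_ker mxrank_tr leq_sub2lE//.
  exact: rank_leq_row.
have /submxP[w hw] := submx_trans (submxMl z^T T^T) sub.
have Tw : T *m (T^T *m w^T) = T *m z.
  by apply: trmx_inj; rewrite !trmx_mul !trmxK -mulmxA -hw.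
exists w^T; split=> //; rewrite ler_sqrt ?dot_ge0// -subr_ge0.
(* Pythagoras: the residual is orthogonal to the projection. *)
have := dot_ge0 (z + -1 *: (T^T *m w^T)); rewrite dotDD.
have -> : dot z (T^T *m w^T) = dot (T^T *m w^T) (T^T *m w^T).
  by rewrite !dot_mulmx trmxK Tw.
rewrite expr2; lra.
Qed.

(** * Maximising linear functionals over polytopes *)

Lemma seq_argmax (I : eqType) (g : I -> R) (s : seq I) x0 : x0 \in s ->
  exists2 y, y \in s & forall z, z \in s -> g z <= g y.
Proof.
elim: s x0 => // a s IH _ _; case: s IH => [|b s] IH.
  by exists a; rewrite ?inE// => z; rewrite inE => /eqP ->.
have [y ys ymax] := IH b (mem_head _ _).
have [le_ay|lt_ya] := leP (g a) (g y).
  exists y => [|z]; rewrite in_cons ?ys ?orbT// => /orP[/eqP->//|]; exact: ymax.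
exists a => [|z]; rewrite in_cons ?eqxx// => /orP[/eqP->//|/ymax le_zy].
exact: ltW (le_lt_trans le_zy lt_ya).
Qed.

(** Finitely many thresholds have a positive minimum, and it serves every element because [Q z]
    holds at all values below its own threshold. *)
Lemma seq_uniform_eps (I : eqType) (Q : I -> R -> Prop) (s : seq I) :
  (forall z, z \in s ->
     exists2 e, 0 < e & forall e', 0 < e' -> e' <= e -> Q z e') ->
  exists2 e, 0 < e & forall z, z \in s -> Q z e.
Proof.
suff h : (forall z, z \in s ->
     exists2 e, 0 < e & forall e', 0 < e' -> e' <= e -> Q z e') ->
  exists2 e, 0 < e & forall e' z, 0 < e' -> e' <= e -> z \in s -> Q z e'.
  by move=> /h[e e0 he]; exists e => // z; exact: he.
elim: s => [_|a s IH hs]; first by exists 1.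
have [|e e0 he] := IH; first by move=> z zs; apply: hs; rewrite inE zs orbT.
have [e1 e10 he1] := hs a (mem_head _ _).
exists (Num.min e e1); first by rewrite lt_min e0.
move=> e' z e'0; rewrite le_min => /andP[lee lee1]; rewrite inE.
by case/orP => [/eqP ->|zs]; [exact: he1|exact: he].
Qed.

(* Among the generators maximising [dot c], one of largest norm, say [p], is
   the only maximiser of [dot (c + e *: p)] for small [e > 0]. *)
Lemma polytope_vertex_max n (P : set 'cV[R]_n) (c : 'cV[R]_n) :
  is_polytope P -> P !=set0 ->
  exists2 p, is_vertex P p & forall x, P x -> dot c x <= dot c p.
Proof.
move=> [S [/finite_seqP[s ->] ->]] [x0 [N0 [w0 [q0 [q0S _ w01 _]]]]].
have {x0 N0 w0 q0 q0S w01}[y0 y0s] : exists y, y \in s.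
  case: N0 w0 q0 q0S w01 => [w0 ? ?|N0 w0 q0 q0S _]; last by exists (q0 0); exact: q0S.
  by rewrite big_ord0 => /esym/eqP; rewrite oner_eq0.
have [y ys ymax] := seq_argmax (dot c) y0s.
have [|p] := @seq_argmax _ (fun z => dot z z) [seq z <- s | dot c z == dot c y] y.
  by rewrite mem_filter eqxx.
rewrite mem_filter => /andP[/eqP cpy ps] pmax.
have [e e0 he] : exists2 e, 0 < e & forall z, z \in s -> z != p ->
    dot (c + e *: p) z < dot (c + e *: p) p.
  apply: seq_uniform_eps => z zs; have [->|zp] := eqVneq z p; first by exists 1.
  have [czy|czy] := eqVneq (dot c z) (dot c y).
    (* Among ties for [c], [dot z z <= dot p p] and [z != p] force [dot p z < dot p p], so any
       [e > 0] works. *)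
    exists 1 => // e e0 _ _; rewrite !dotDl !dotZl czy cpy ltrD2l ltr_pM2l//.
    have /pmax : z \in [seq z <- s | dot c z == dot c y].
      by rewrite mem_filter czy eqxx.
    have : 0 < dot (p + -1 *: z) (p + -1 *: z).
      by rewrite dot_gt0// scaleN1r subr_eq0 eq_sym.
    rewrite dotDD expr2; lra.
  have {}czy : dot c z < dot c p by rewrite cpy lt_neqAle czy ymax.
  set b := dot p z - dot p p; have b0 := normr_ge0 b.
  (* The gap in [c] must outweigh the perturbation [e * b]; the [+ 1] keeps the denominator
     positive. *)
  exists ((dot c p - dot c z) / (`|b| + 1)) => [|e e0].
    by rewrite divr_gt0// ?subr_gt0//; lra.
  rewrite ler_pdivlMr; last lra.
  move=> le_e _; rewrite !dotDl !dotZl.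
  have : e * b <= e * `|b| by rewrite ler_pM2l// ler_norm.
  rewrite {1}/b; lra.
have le_conv d x : (forall z, z \in s -> dot d z <= dot d p) ->
    convex_hull [set` s] x -> dot d x <= dot d p.
  move=> dp [N [w [q [qs w0 w1 ->]]]]; rewrite dot_sumr.
  rewrite -[leRHS]mul1r -w1 mulr_suml; apply: ler_sum => i _.
  by rewrite ler_wpM2l//; apply: dp; exact: qs.
have he' z : z \in s -> dot (c + e *: p) z <= dot (c + e *: p) p.
  by move=> zs; have [->//|zp] := eqVneq z p; exact/ltW/he.
exists p; last by move=> x; apply: le_conv => z zs; rewrite cpy; exact: ymax.
exists (c + e *: p), (dot (c + e *: p) p); split; first by move=> x; exact: le_conv.
apply/seteqP; split => [_ ->|x [[N [w [q [qs w0 w1 ->]]]]]] /=.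
  split=> //; exists 1%N, (fun=> 1), (fun=> p); split => //.
  - by rewrite big_ord1.
  - by rewrite big_ord1 scale1r.
(* A weighted sum of nonnegative deficits vanishes, so each generator either has weight zero or
   equals [p]. *)
rewrite dot_sumr => /eqP; rewrite -subr_eq0 -[X in _ - X]mul1r -w1 mulr_suml.
rewrite -sumrB -oppr_eq0 -sumrN psumr_eq0 => [/allP h|i _]; last first.
  by rewrite oppr_ge0 subr_le0 ler_wpM2l// he'//; exact: qs.
rewrite -[RHS]scale1r -w1 scaler_suml; apply: eq_bigr => i _.
have := h i (mem_index_enum _); rewrite oppr_eq0 -mulrBr mulf_eq0.
case/orP => [/eqP ->|]; first by rewrite !scale0r.
rewrite subr_eq0; have [-> //|qp] := eqVneq (q i) p.
by rewrite lt_eqF// he//; exact: qs.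
Qed.

(** * Continuity of the maps that define the cones *)

Lemma continuous_sumr (T : topologicalType) I (s : seq I) (F : I -> T -> R) :
  (forall i, continuous (F i)) -> continuous (fun x => \sum_(i <- s) F i x).
Proof.
move=> cF; elim: s => [|i s IH] x.
  by under eq_fun do rewrite big_nil; exact: cvg_cst.
by under eq_fun do rewrite big_cons; apply: cvgD; [exact: cF|exact: IH].
Qed.

Lemma continuous_mulmx p k l (M : 'M[R]_(p, k)) i j :
  continuous (fun z : 'M[R]_(k, l) => (M *m z) i j).
Proof.
under [X in continuous X]eq_fun do rewrite mxE.
apply: continuous_sumr => h z.
by apply: continuousM; [exact: cst_continuous|exact: coord_continuous].
Qed.

Lemma continuous_enorm_mulmx p k (M : 'M[R]_(p, k)) :
  continuous (fun z : 'cV[R]_k => enorm (M *m z)).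
Proof.
have cd : continuous (fun z : 'cV[R]_k => dot (M *m z) (M *m z)).
  by apply: continuous_sumr => h z; apply: continuousM; exact: continuous_mulmx.
by move=> z; apply: (continuous_comp (cd z)); exact: sqrt_continuous.
Qed.

Lemma continuous_dotr k (a : 'cV[R]_k) : continuous (dot a : 'cV[R]_k -> R).
Proof.
apply: continuous_sumr => h z.
by apply: continuousM; [exact: cst_continuous|exact: coord_continuous].
Qed.

(** A neighbourhood of a matrix contains a product of neighbourhoods of its finitely many
    entries. *)
Lemma continuous_coord_mx (T : topologicalType) p k (g : T -> 'M[R]_(p, k)) :
  (forall i j, continuous (fun x => g x i j)) -> continuous g.
Proof.
move=> cg x A [Q nQ sQ]; rewrite /= nbhs_filterE /=.
have : \forall y \near x, forall i j, Q i j (g y i j).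
  by do 2 apply: filter_forall => ?; apply: cg; exact: nQ.
by apply: filterS => y Qy; exact: sQ.
Qed.

Lemma continuous_usubmx m k : continuous (usubmx : 'cV[R]_(m + k) -> 'cV[R]_m).
Proof.
apply: continuous_coord_mx => i j.
by under eq_fun do rewrite mxE; exact: coord_continuous.
Qed.

Lemma continuous_dsubmx m k : continuous (dsubmx : 'cV[R]_(m + k) -> 'cV[R]_k).
Proof.
apply: continuous_coord_mx => i j.
by under eq_fun do rewrite mxE; exact: coord_continuous.
Qed.

(** * Closed convex cones and their products *)

Lemma convex_setP k (C : set 'cV[R]_k) :
  convex_set C <->
  forall (t : R) x y, 0 <= t -> t <= 1 -> C x -> C y ->
    C (t *: x + (1 - t) *: y).
Proof.
split=> [cC t x y t0 t1 Cx Cy|cC x y t /set_mem Cx /set_mem Cy].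
  have t01 : Itv.spec (@Itv.num_sem R) (Itv.Real `[0%Z, 1%Z]) t.
    by rewrite /Itv.spec/= /Itv.num_sem/= in_itv/= t0 t1 num_real.
  exact: set_mem (cC x y (Itv.mk t01) (mem_set Cx) (mem_set Cy)).
by apply/mem_set/cC.
Qed.

Lemma convex_cone_add k (C : set 'cV[R]_k) x y :
  closed_convex_cone C -> C x -> C y -> C (x + y).
Proof.
move=> [_ /convex_setP cC _ sC] Cx Cy.
have -> : x + y = 2 *: (2^-1 *: x + (1 - 2^-1) *: y).
  by rewrite scalerDr !scalerA mulrBr mulr1 mulfV// addrK !scale1r.
by apply: sC => //; apply: cC => //; lra.
Qed.

Lemma SOC_closed_convex_cone p k (N : 'M[R]_(p, k)) (a : 'cV[R]_k) :
  closed_convex_cone [set z | enorm (N *m z) <= dot a z].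
Proof.
have sS (c : R) z : 0 <= c -> enorm (N *m z) <= dot a z ->
    enorm (N *m (c *: z)) <= dot a (c *: z).
  by move=> c0 h; rewrite -scalemxAr enormZ dotZr ger0_norm// ler_wpM2l.
split=> //.
- rewrite (_ : mkset _ =
      (fun z => dot a z - enorm (N *m z)) @^-1` [set x | 0 <= x]).
    have /continuous_closedP h : continuous (fun z => dot a z - enorm (N *m z)).
      move=> z; apply: continuousB; first exact: continuous_dotr.
      exact: continuous_enorm_mulmx.
    by apply: h; exact: closed_ge.
  by apply/seteqP; split=> z /=; rewrite subr_ge0.
- apply/convex_setP => t x y t0 t1 hx hy; rewrite /= mulmxDr dotDr.
  by apply: le_trans (ler_enormD _ _) _; apply: lerD; apply: sS; rewrite ?subr_ge0.
- by rewrite /= mulmx0 dot0r -(scale0r 0) enormZ normr0 mul0r.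
Qed.

Lemma prod_coneE m k (K : set 'cV[R]_m) (C : set 'cV[R]_k) :
  prod_cone K C = (usubmx @^-1` K) `&` (dsubmx @^-1` C).
Proof.
apply/seteqP; split=> [_ [y Ky [z Cz <-]]|x [Kx Cx]] /=.
  by rewrite col_mxKu col_mxKd.
by exists (usubmx x) => //; exists (dsubmx x); rewrite ?vsubmxK.
Qed.

Lemma prod_cone_closed_convex m k (K : set 'cV[R]_m) (C : set 'cV[R]_k) :
  closed_convex_cone K -> closed_convex_cone C ->
  closed_convex_cone (prod_cone K C).
Proof.
move=> [clK /convex_setP cvK K0 coK] [clC /convex_setP cvC C0 coC].
rewrite prod_coneE; split.
- have /continuous_closedP hu := @continuous_usubmx m k.
  have /continuous_closedP hd := @continuous_dsubmx m k.
  by apply: closedI; [exact: hu|exact: hd].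
- apply/convex_setP => t x y t0 t1 [/= Kx Cx] [/= Ky Cy].
  by split; rewrite /= !linearD !linearZ /=; [exact: cvK|exact: cvC].
- by split; rewrite /= linear0.
- by move=> c x c0 [/= Kx Cx]; split; rewrite /= linearZ; [exact: coK|exact: coC].
Qed.

(** * Affine slices of product cones *)

Lemma affine_subspace_mulmx p k (G : 'M[R]_(p, k)) (z0 : 'cV[R]_k) :
  affine_subspace [set z : 'cV[R]_k | G *m z = G *m z0].
Proof.
exists z0, (lker (linfun (mulmx G))); apply/seteqP; split=> z /=.
  by move=> Gz; rewrite /flat /= memv_ker lfunE /= mulmxBr Gz subrr.
by rewrite /flat /= memv_ker lfunE /= mulmxBr subr_eq0 => /eqP.
Qed.

Lemma affine_subspace_convex k (L : set 'cV[R]_k) (t : R) x y :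
  affine_subspace L -> L x -> L y -> L (t *: x + (1 - t) *: y).
Proof.
move=> [x0 [U ->]]; rewrite /flat /= => xU yU.
have -> : t *: x + (1 - t) *: y - x0 = t *: (x - x0) + (1 - t) *: (y - x0).
  rewrite !scalerBr addrACA -opprD -scalerDl addrC.
  by rewrite (addrC t) subrK scale1r addrC.
by rewrite memvD// memvZ.
Qed.

(* The affine subspace couples the two factors of the product cone: its points
   are the [col_mx (U *m w) w] with [dot b w = 1]. *)
Lemma SOC_slice_lift m n k p (K : set 'cV[R]_m) (N : 'M[R]_(p, k))
    (U : 'M[R]_(m, k)) (D : 'M[R]_(n, k)) (a b w0 : 'cV[R]_k) :
  closed_convex_cone K -> dot b w0 = 1 ->
  has_cone_SOC_lift K k
    [set D *m w | w in
      [set w | [/\ enorm (N *m w) <= dot a w, dot b w = 1 & K (U *m w)]]].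
Proof.
move=> hK bw0; have [Q hQ] := gram_square_factor N.
(* Norms depend only on the Gram matrix, so the square [Q] may replace the rectangular [N]. *)
have QN w : enorm (Q *m w) = enorm (N *m w).
  by rewrite /enorm !dot_mulmx !mulmxA hQ.
have hC := SOC_closed_convex_cone Q a; set C := [set _ | _] in hC.
exists C; split.
  exists (N^T *m N), Q, a; split=> //; split; first by rewrite trmx_mul trmxK.
  by move=> z; rewrite -mulmxA dot_mulmx trmxK dot_ge0.
pose G : 'M[R]_(m + 1, m + k) := block_mx 1%:M (- U) 0 b^T.
(* An affine subspace is nonempty by definition; [w0] supplies its base point. *)
pose z0 := col_mx (U *m w0) w0.
have GE (y : 'cV[R]_m) w : G *m col_mx y w = col_mx (y - U *m w) (dot b w)%:M.
  rewrite mul_block_col mul1mx mulNmx mul0mx add0r; congr col_mx.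
  by rewrite [LHS]mx11_scalar -dotE.
pose L := [set z | G *m z = G *m z0].
have affL : affine_subspace L by exact: affine_subspace_mulmx.
have LE (y : 'cV[R]_m) w : L (col_mx y w) <-> y = U *m w /\ dot b w = 1.
  rewrite /L /= !GE subrr bw0; split=> [/eq_col_mx[/subr0_eq -> /matrixP/(_ 0 0)]|].
    by rewrite !mxE !mulr1n.
  by move=> [-> ->]; rewrite subrr.
have hP := prod_cone_closed_convex hK hC.
have imE : [set D *m w | w in
      [set w | [/\ enorm (N *m w) <= dot a w, dot b w = 1 & K (U *m w)]]] =
    mulmx (row_mx 0 D) @` (prod_cone K C `&` L).
  apply/seteqP; split=> [_ [w [aw bw KUw] <-]|_ [_ [[y Ky [w Cw <-]] /LE[yE bw]] <-]].
    exists (col_mx (U *m w) w); last by rewrite mul_row_col mul0mx add0r.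
    split; last exact/LE.
    by exists (U *m w) => //; exists w => //; rewrite /C /= QN.
  exists w; last by rewrite mul_row_col mul0mx add0r.
  by split=> //; [rewrite -QN|rewrite -yE].
split=> //; last by exists L, (mulmx (row_mx 0 D)).
(* Convexity is inherited from the product cone and the affine subspace through the linear image. *)
have [_ /convex_setP cvP _ _] := hP.
rewrite imE; apply/convex_setP => t _ _ t0 t1 [x [Px Lx] <-] [y [Py Ly] <-].
exists (t *: x + (1 - t) *: y); last by rewrite linearD !linearZ.
by split; [exact: cvP|exact: affine_subspace_convex].
Qed.

(** * The origin as a convex combination of the vertices *)

(* First-order optimality at the point of least norm of the convex hull of the
   columns of [V]. *)
Lemma min_norm_convex_hull n v (V : 'M[R]_(n, v.+1)) :
  exists q : 'cV[R]_v.+1, [/\ orthant q, dot (ones v.+1) q = 1 &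
    forall j, dot (V *m q) (V *m q) <= dot (V *m q) (col j V)].
Proof.
(* The simplex is a closed subset of a cube of row vectors, which is compact as a product of
   segments. *)
pose simplex : set 'rV[R]_v.+1 :=
  [set q : 'rV[R]_v.+1 | forall j, `[0, 1]%classic (q ord0 j)] `&`
  [set q : 'rV[R]_v.+1 | dot (ones v.+1) q^T = 1].
pose g (q : 'rV[R]_v.+1) := dot (V *m q^T) (V *m q^T).
have cmx p (M : 'M[R]_(p, v.+1)) i : continuous (fun q : 'rV[R]_v.+1 => (M *m q^T) i 0).
  under [X in continuous X]eq_fun do rewrite -[_ *m _]trmxK trmx_mul trmxK mxE mxE.
  apply: continuous_sumr => h z; apply: continuousM; last exact: cst_continuous.
  exact: coord_continuous.
have cg : continuous g.
  by apply: continuous_sumr => i q; apply: continuousM; exact: cmx.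
have inS (q : 'cV[R]_v.+1) : orthant q -> dot (ones v.+1) q = 1 -> simplex q^T.
  move=> q0 q1; split=> /= [j|]; last by rewrite trmxK.
  rewrite mxE in_itv /= q0 -q1 /dot (bigD1 j)//= mxE mul1r lerDl.
  by rewrite sumr_ge0// => i _; rewrite mxE mul1r.
have simplex0 : simplex !=set0.
  exists (delta_mx 0 0 : 'cV[R]_v.+1)^T; apply: inS.
    by move=> i; rewrite mxE ler0n.
  by rewrite dotC dotE trmx_delta -rowE !mxE.
have cS : compact simplex.
  apply: compact_closedI.
    have := @rV_compact R v.+1 (fun=> `[0, 1]%classic) (fun=> @segment_compact _ 0 1).
    exact.
  have /continuous_closedP h : continuous (fun q : 'rV[R]_v.+1 => dot (ones v.+1) q^T).
    under [X in continuous X]eq_fun do rewrite dotE.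
    exact: cmx.
  by apply: (h [set x | x = 1]); exact: closed_eq.
have [q] := compact_EVT_min simplex0 cS (continuous_subspaceT cg).
rewrite inE => -[q01 /= q1] qmin; exists q^T.
have q0 : orthant q^T by move=> j; rewrite mxE; have := q01 j; rewrite /= in_itv => /andP[].
split=> // j; set x := V *m q^T; set d := col j V - x.
suff : 0 <= dot x d by rewrite /d dotDr -scaleN1r dotZr; lra.
rewrite leNgt; apply/negP => xd0; have d0 := dot_ge0 d.
(* Moving from [x] by [t *: d] changes the squared norm by [t * (2 * dot x d + t * dot d d)]. This
   [t] keeps [t * dot d d] below [- dot x d], so the change is negative. *)
pose t := Num.min 1 (- dot x d / (dot d d + 1)).
have t0 : 0 < t by rewrite lt_min ltr01 divr_gt0 ?oppr_gt0//; lra.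
have t1 : t <= 1 by rewrite ge_min lexx.
have td : t * (dot d d + 1) <= - dot x d.
  by rewrite -ler_pdivlMr ?ge_min ?lexx ?orbT//; lra.
pose z := (1 - t) *: q^T + t *: delta_mx j 0.
have gz : simplex z^T -> dot x x <= dot (V *m z) (V *m z).
  by move=> zS; have := qmin z^T (mem_set zS); rewrite /g trmxK.
have Vz : V *m z = x + t *: d.
  rewrite mulmxDr -!scalemxAr -colE -/x /d scalerBl scale1r scalerBr.
  by rewrite addrA addrAC.
suff : 2 * t * dot x d + t ^+ 2 * dot d d < 0.
  have /gz : simplex z^T; last by rewrite Vz dotDD; lra.
  apply: inS => [i|].
    rewrite !mxE addr_ge0// mulr_ge0 ?ler0n ?subr_ge0// ?(ltW t0)//.
    by have := q0 i; rewrite mxE.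
  rewrite dotDr !dotZr q1 [dot _ (delta_mx _ _)]dotC dotE trmx_delta -rowE !mxE.
  lra.
rewrite expr2 (mulrC 2) -!mulrA -mulrDr pmulr_rlt0//; lra.
Qed.

(** Every functional is nonnegative at some vertex, since its maximum over [P] is attained at one
    and [P] contains 0. If the point [x] of least norm in the hull of the vertices were nonzero, the
    functional [- x] would be negative at all of them. *)
Lemma origin_in_vertex_hull n v (P : set 'cV[R]_n) (V : 'M[R]_(n, v)) :
  is_polytope P -> P 0 -> columns_are_vertices P V ->
  exists q : 'cV[R]_v, [/\ orthant q, dot (ones v) q = 1 & V *m q = 0].
Proof.
move=> polyP P0 [_ vertV].
have vert c : exists j, 0 <= dot c (col j V).
  have [p /vertV[j ->] pmax] := polytope_vertex_max c polyP (ex_intro _ 0 P0).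
  by exists j; have := pmax 0 P0; rewrite dot0r.
case: v V vertV vert => [|v] V vertV vert; first by have [[]] := vert 0.
have [q [q0 q1 qmin]] := min_norm_convex_hull V; exists q; split=> //.
apply: dot_eq0; apply/eqP; rewrite eq_le dot_ge0 andbT.
have [j] := vert (-1 *: (V *m q)).
by rewrite dotZl; have := qmin j; lra.
Qed.

(** * The lifts of [Inn] and [Out] *)

Lemma Inn_lift n m f (H : 'M[R]_(n, f)) (K : set 'cV[R]_m) (A : 'M[R]_(m, f)) :
  closed_convex_cone K -> has_cone_SOC_lift K (n + m + 2)%N (Inn H K A).
Proof.
move=> hK.
(* [M] is the slack in [Inn], made linear by a coordinate [s] that [b] fixes to 1; a fourth
   coordinate pads the dimension to [n + m + 2]. *)
pose M : 'M[R]_(f, n + m + (1 + 1)) :=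
  row_mx (row_mx (- H^T) (- A^T)) (row_mx (ones f) 0).
pose b : 'cV[R]_(n + m + (1 + 1)) := col_mx 0 (col_mx 1%:M 0).
pose U : 'M[R]_(m, n + m + (1 + 1)) := row_mx (row_mx 0 1%:M) 0.
pose D : 'M[R]_(n, n + m + (1 + 1)) := row_mx (row_mx 1%:M 0) 0.
pose r : R := Num.sqrt (f%:R - 1).
pose w (x : 'cV[R]_n) (y : 'cV[R]_m) (s t : 'cV[R]_1) := col_mx (col_mx x y) (col_mx s t).
have wE z : exists x y s t, z = w x y s t.
  exists (usubmx (usubmx z)), (dsubmx (usubmx z)), (usubmx (dsubmx z)), (dsubmx (dsubmx z)).
  by rewrite /w !vsubmxK.
have Mw x y t : M *m w x y 1%:M t = ones f - H^T *m x - A^T *m y.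
  by rewrite !mul_row_col !mulNmx mulmx1 mul0mx addr0 addrC addrA.
have Uw x y s t : U *m w x y s t = y.
  by rewrite !mul_row_col !mul0mx mul1mx addr0 add0r.
have Dw x y s t : D *m w x y s t = x.
  by rewrite !mul_row_col !mul0mx mul1mx !addr0.
have bw x y s t : dot b (w x y s t) = s 0 0.
  by rewrite !dot_col_mx !(dotC 0) !dot0r addr0 add0r dotE trmx1 mul1mx.
have b1 : dot b (w 0 0 1%:M 0) = 1 by rewrite bw mxE.
(* The factor [r] of [O_in] is absorbed into the matrix, and [M^T *m ones f] expresses the
   coordinate sum of [M *m w]. *)
have := SOC_slice_lift (r *: M) U D (M^T *m ones f) hK b1.
congr has_cone_SOC_lift; apply/seteqP; split=> [_ [z [Nz bz Kz] <-]|x [y [Ky Oy]]].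
  have [x [y [s [t zE]]]] := wE z; move: Nz bz Kz; rewrite {}zE Uw Dw bw => Nz s1 Ky.
  have sE : s = 1%:M by rewrite [LHS]mx11_scalar s1.
  exists y; split=> //; move: Nz.
  by rewrite sE -dot_mulmx -scalemxAl Mw enormZ ger0_norm ?sqrtr_ge0.
exists (w x y 1%:M 0); last exact: Dw.
split; [|by rewrite bw mxE|by rewrite Uw].
by rewrite -dot_mulmx -scalemxAl Mw enormZ ger0_norm ?sqrtr_ge0.
Qed.

(* A point [z] of slack [1 - dot ones z] is moved to the hyperplane
   [dot ones z = 1] by adding a multiple of [q], and then replaced by its
   projection [T^T *m w] on the row space of [T]. *)
Lemma Out_lift n m v (V : 'M[R]_(n, v)) (K : set 'cV[R]_m) (B : 'M[R]_(m, v))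
    (q : 'cV[R]_v) :
  closed_convex_cone K -> nonneg_map K B ->
  orthant q -> dot (ones v) q = 1 -> V *m q = 0 ->
  has_cone_SOC_lift K (n + m + 2)%N (Out V K B).
Proof.
move=> hK hB q0 q1 Vq0.
(* The zero row brings the number of rows to [n + m + 2]. *)
pose T : 'M[R]_(n + m + (1 + 1), v) := col_mx (col_mx V B) (col_mx (ones v)^T 0).
have TE z : T *m z = col_mx (col_mx (V *m z) (B *m z)) (col_mx (dot (ones v) z)%:M 0).
  by rewrite !mul_col_mx mul0mx [(ones v)^T *m z]mx11_scalar -dotE.
have Tinj z z' : T *m z = T *m z' ->
    [/\ V *m z = V *m z', B *m z = B *m z' & dot (ones v) z = dot (ones v) z'].
  rewrite !TE => /eq_col_mx[/eq_col_mx[-> ->] /eq_col_mx[/matrixP/(_ 0 0)]].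
  by rewrite !mxE !mulr1n.
have aE w : dot (T *m ones v) w = dot (ones v) (T^T *m w).
  by rewrite dot_mulmx trmxK.
have [w0 [/Tinj[_ _ w01] _]] := row_space_projection T q.
have b1 : dot (T *m ones v) w0 = 1 by rewrite aE w01.
have := SOC_slice_lift T^T (B *m T^T) (V *m T^T) (T *m ones v) hK b1.
congr has_cone_SOC_lift; apply/seteqP; split=> [_ [w [Nw bw Kw] <-]|_ [z [Oz z1 Kz] <-]].
  exists (T^T *m w); last by rewrite mulmxA.
  by split; rewrite ?mulmxA//; [rewrite /O_out /= -aE|rewrite -aE bw].
(* Adding [s *: q] keeps the image under [V], since [V *m q = 0], and keeps [B] in [K], since
   [B *m q] lies in the cone [K]. *)
pose s := 1 - dot (ones v) z; have s0 : 0 <= s by rewrite subr_ge0.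
have [w [/Tinj[Vw Bw w1] Nw]] := row_space_projection T (z + s *: q).
have zq1 : dot (ones v) (z + s *: q) = 1 by rewrite dotDr dotZr q1 mulr1 addrC subrK.
exists w; last by rewrite -mulmxA Vw mulmxDr -scalemxAr Vq0 scaler0 addr0.
split; [|by rewrite aE w1|].
  (* Projection does not increase the norm; the triangle inequality then treats [z] by [O_out] and
     [q] by [enorm_orthant]. *)
  rewrite aE w1 (le_trans Nw)// (le_trans (ler_enormD _ _))// dotDr lerD//.
  by rewrite enormZ dotZr ger0_norm// ler_wpM2l// enorm_orthant.
rewrite -mulmxA Bw mulmxDr -scalemxAr; apply: convex_cone_add => //.
by have [_ _ _ coK] := hK; apply: coK => //; exact: hB.
Qed.

End Euclidean.

Theorem theorem2p18 (R : realType) (n m f v : nat)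
    (H : 'M[R]_(n, f)) (V : 'M[R]_(n, v)) (K : set 'cV[R]_m)
    (A : 'M[R]_(m, f)) (B : 'M[R]_(m, v))
    (P_polytope : is_polytope (polyhedron H))
    (P_fulldim : affine_dim (polyhedron H) n)
    (P_origin : interior (polyhedron H) 0)
    (H_facets : columns_define_facets (polyhedron H) H)
    (V_vertices : columns_are_vertices (polyhedron H) V)
    (K_cone : closed_convex_cone K)
    (A_nonneg : nonneg_map (dual_cone K) A)
    (B_nonneg : nonneg_map K B) :
  has_cone_SOC_lift K (n + m + 2)%N (Inn H K A) /\
  has_cone_SOC_lift K (n + m + 2)%N (Out V K B).
Proof.
split; first exact: Inn_lift.
have P0 := interior_subset P_origin.
have [q [q0 q1 Vq0]] := origin_in_vertex_hull P_polytope P0 V_vertices.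
exact: Out_lift Vq0.
Qed.
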